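(* Let $P$ be a finite-dimensional symplectic manifold with a free, proper, symplectic action of a Lie group $G$ with Lie algebra $\mathfrak g$, and let $J\colon P\to\mathfrak g^*$ be an equivariant momentum map. Let $H$ be a $G$-invariant Hamiltonian on $P$ with a relative equilibrium at $p_e$, and let $\mu_e=J(p_e)$. Let $S$ be a slice transverse to the orbit $Gp_e$ at $p_e$. Then $p_e$ is $G$-stable if there exist an open neighbourhood $U_S$ of $p_e$ in $S$ and an open neighbourhood $U_{\mu_e}$ of $\mu_e$ in $\mathfrak g^*$ such that $$H^{-1}\bigl(H(p_e)\bigr)\cap J^{-1}\bigl(T_2^{U_{\mu_e}}(\mu_e)\bigr)\cap U_S=\{p_e\}.$$ This remains true if $H$ is replaced in this condition by any conserved quantity with values in any Hausdorff space.
   Context: Equivariance of $J$ is with respect to the coadjoint action of $G$ on $\mathfrak g^*$: $J(gp)=\mathrm{Ad}^*_{g^{-1}}J(p)$. $X_H$ is the Hamiltonian vector field of $H$ and $\Phi_t$ its ($G$-equivariant) flow. A conserved quantity is a continuous map that is constant along trajectories of $\Phi_t$. A point $p_e$ is a relative equilibrium if $X_H(p_e)=\xi_ep_e$ for some $\xi_e\in\mathfrak g$ ($\xi_ep_e$ being the infinitesimal action of $\xi_e$ at $p_e$). It is $G$-stable if for every $G$-invariant neighbourhood $U$ of $p_e$ there is a neighbourhood $V$ of $p_e$ such that $\Phi_t(p)\in U$ for all $p\in V$ and all $t$. A slice at $p_e$ is a submanifold $S\subseteq P$ through $p_e$ with $T_{p_e}P=T_{p_e}(Gp_e)\oplus T_{p_e}S$,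 small enough that the projection $P\to P/G$ maps $S$ diffeomorphically onto an open neighbourhood of $Gp_e$ in $P/G$. $\mathfrak g^*$ carries its Lie-Poisson structure, whose symplectic leaves are the (connected components of) coadjoint orbits. For an open set $U\subseteq\mathfrak g^*$ and $\mu\in U$, $L^U(\mu)$ is the connected symplectic leaf through $\mu$ of the Poisson manifold $U$ (the connected component of the coadjoint orbit intersected with $U$ that contains $\mu$), $Z^U$ is the space of these leaves with the quotient topology from $L^U\colon U\to Z^U$, and $T_2^U(\mu)=(L^U)^{-1}\bigl(T_2(L^U(\mu))\bigr)$. Here, for a point $y$ of a topological space $Y$, $T_2(y)$ is the set of $y'\in Y$ such that every neighbourhood of $y$ meets every neighbourhood of $y'$.
   Formalization: In the last sentence the conserved quantity replacing H is also required to be G-invariant, as H is; without this the claim fails, e.g. for the free rigid body on T*SO(3) rotating about its middle axis with the conserved quantity J. *)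

(* Defs.v *)
From HB Require Import structures.
From mathcomp Require Import all_boot all_order all_algebra.
From mathcomp Require Import all_classical all_reals all_analysis.
Set Implicit Arguments.
Unset Strict Implicit.
Unset Printing Implicit Defensive.
Import Order.TTheory GRing.Theory Num.Theory.
Import numFieldNormedType.Exports.

Local Open Scope classical_set_scope.
Local Open Scope ring_scope.

(* For finite-dimensional V, f is C^(k+1) on the open set O iff it is
   differentiable there and all its directional derivatives are C^k. *)
Fixpoint Ck (R : realType) (V W : normedModType R) (k : nat) (O : set V)
    (f : V -> W) : Prop :=
  if k is k'.+1 then
    (forall x, O x -> differentiable f x) /\
    (forall v, Ck k' O (fun x => 'D_v f x))
  else forall x, O x -> {for x, continuous f}.

Definition Cinf (R : realType) (V W : normedModType R) (O : set V)
    (f : V -> W) : Prop := forall k, Ck k O f.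

(* [cmap] and [cinv] are total functions, meaningful on [cdom] and [cimg]
   only, where they are mutually inverse homeomorphisms. *)
Record chart (R : realType) (n : nat) (M : topologicalType) := Chart {
  cdom : set M;
  cimg : set 'rV[R]_n;
  cmap :> M -> 'rV[R]_n;
  cinv : 'rV[R]_n -> M;
  cdom_open : open cdom;
  cimg_open : open cimg;
  cmap_img : forall x, cdom x -> cimg (cmap x);
  cinv_dom : forall u, cimg u -> cdom (cinv u);
  cmapK : forall x, cdom x -> cinv (cmap x) = x;
  cinvK : forall u, cimg u -> cmap (cinv u) = u;
  cmap_continuous : forall x, cdom x -> {for x, continuous cmap};
  cinv_continuous : forall u, cimg u -> {for u, continuous cinv}
}.

Definition smooth_transition (R : realType) (n : nat) (M : topologicalType)
    (c d : chart R n M) : Prop :=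
  Cinf [set u | cimg c u /\ cdom d (cinv c u)] (d \o cinv c).

(* [chart_at p] is a preferred chart around p.  It serves to represent the
   tangent space T_pM by 'rV[R]_n: a tangent vector at p is identified with its
   components in [chart_at p].  Any other choice gives isomorphic data. *)
Record manifold (R : realType) (n : nat) := Manifold {
  mcarrier :> topologicalType;
  atlas : set (chart R n mcarrier);
  chart_at : mcarrier -> chart R n mcarrier;
  chart_at_atlas : forall p, atlas (chart_at p);
  chart_at_dom : forall p, cdom (chart_at p) p;
  atlas_smooth : forall c d, atlas c -> atlas d -> smooth_transition c d;
  manifold_hausdorff : hausdorff_space mcarrier;
  manifold_second_countable : @second_countable mcarrier
}.

(* membership in the maximal atlas *)
Definition smooth_chart (R : realType) (n : nat) (M : manifold R n)
    (c : chart R n M) : Prop :=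
  forall d, atlas d -> smooth_transition c d /\ smooth_transition d c.

Definition smooth_fun (R : realType) (n : nat) (M : manifold R n)
    (V : normedModType R) (f : M -> V) : Prop :=
  forall c : chart R n M, atlas c -> Cinf (cimg c) (f \o cinv c).

Definition smooth_on (R : realType) (m n : nat) (M : manifold R m)
    (N : manifold R n) (O : set M) (f : M -> N) : Prop :=
  (forall x, O x -> {for x, continuous f}) /\
  forall (c : chart R m M) (d : chart R n N), atlas c -> atlas d ->
    Cinf [set u | [/\ cimg c u, O (cinv c u) & cdom d (f (cinv c u))]]
         (d \o f \o cinv c).

Definition smooth_map (R : realType) (m n : nat) (M : manifold R m)
    (N : manifold R n) (f : M -> N) : Prop := smooth_on setT f.

(* smoothness of a map on the product manifold M * N, in product charts *)
Definition smooth_map2 (R : realType) (m n k : nat) (M : manifold R m)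
    (N : manifold R n) (K : manifold R k) (f : M -> N -> K) : Prop :=
  continuous (fun z : M * N => f z.1 z.2) /\
  forall (c : chart R m M) (d : chart R n N) (e : chart R k K),
    atlas c -> atlas d -> atlas e ->
    Cinf [set u : 'rV[R]_m * 'rV[R]_n |
            [/\ cimg c u.1, cimg d u.2 & cdom e (f (cinv c u.1) (cinv d u.2))]]
         (fun u => e (f (cinv c u.1) (cinv d u.2))).

Definition tangent_map (R : realType) (m n : nat) (M : manifold R m)
    (N : manifold R n) (f : M -> N) (x : M) : 'rV[R]_m -> 'rV[R]_n :=
  'd (chart_at (f x) \o f \o cinv (chart_at x)) (chart_at x x).

Definition differential (R : realType) (n : nat) (M : manifold R n)
    (f : M -> R) (x : M) : 'rV[R]_n -> R :=
  'd (f \o cinv (chart_at x)) (chart_at x x).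

Definition has_velocity (R : realType) (n : nat) (M : manifold R n)
    (c : R -> M) (t : R) (v : 'rV[R]_n) : Prop :=
  {for t, continuous c} /\ is_derive t 1 (fun s => chart_at (c t) (c s)) v.

(* embedded submanifold: locally flattened by charts of the maximal atlas *)
Definition submanifold (R : realType) (n : nat) (M : manifold R n)
    (S : set M) : Prop :=
  exists2 k : nat, (k <= n)%N &
  forall p, S p -> exists c : chart R n M, [/\ smooth_chart c, cdom c p &
    c @` (cdom c `&` S) =
    cimg c `&` [set u | forall i : 'I_n, (k <= i)%N -> u 0 i = 0]].

Definition tangent_space (R : realType) (n : nat) (M : manifold R n)
    (S : set M) (p : M) : set 'rV[R]_n :=
  [set v | exists c : R -> M,
    [/\ c 0 = p, (\forall t \near 0, S (c t)) & has_velocity c 0 v]].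

Definition bil (R : realType) (n : nat) (A : 'M[R]_n) (v w : 'rV[R]_n) : R :=
  (v *m A *m w^T) 0 0.

(* The 2-form is given at p by its matrix in the chart [chart_at p]; [chart_form
   omega c u] is its expression at the point u of an arbitrary chart c. *)
Definition chart_form (R : realType) (n : nat) (M : manifold R n)
    (omega : M -> 'M[R]_n) (c : chart R n M) (u v w : 'rV[R]_n) : R :=
  let tau := 'd (chart_at (cinv c u) \o cinv c) u in
  bil (omega (cinv c u)) (tau v) (tau w).

Record symplectic_form (R : realType) (n : nat) (M : manifold R n)
    (omega : M -> 'M[R]_n) : Prop := SymplecticForm {
  form_alternating : forall p v, bil (omega p) v v = 0;
  form_nondegenerate :
    forall p v, (forall w, bil (omega p) v w = 0) -> v = 0;
  form_smooth : forall c : chart R n M, atlas c ->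
    forall v w, Cinf (cimg c) (fun u => chart_form omega c u v w);
  (* d omega (a, v, w) on constant coordinate vector fields a, v, w *)
  form_closed : forall c : chart R n M, atlas c ->
    forall u, cimg c u -> forall a v w,
      'D_a (fun x => chart_form omega c x v w) u
    + 'D_v (fun x => chart_form omega c x w a) u
    + 'D_w (fun x => chart_form omega c x a v) u = 0
}.

(* sign convention: omega(X_f, -) = df *)
Definition hamiltonian_field (R : realType) (n : nat) (M : manifold R n)
    (omega : M -> 'M[R]_n) (f : M -> R) (X : M -> 'rV[R]_n) : Prop :=
  forall p w, bil (omega p) (X p) w = differential f p w.

(* The maximal flow (t, p) |-> Phi t p of the vector field X, with open domain
   D; completeness of X is not assumed. *)
Record is_flow (R : realType) (n : nat) (M : manifold R n)
    (X : M -> 'rV[R]_n) (D : set (R * M)) (Phi : R -> M -> M) : Prop := IsFlow {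
  flow_open : open D;
  flow_continuous :
    forall z, D z -> {for z, continuous (fun z : R * M => Phi z.1 z.2)};
  flow_interval : forall p, is_interval [set t | D (t, p)];
  flow_dom0 : forall p, D (0, p);
  flow0 : forall p, Phi 0 p = p;
  flow_integral :
    forall t p, D (t, p) -> has_velocity (Phi^~ p) t (X (Phi t p));
  flow_maximal : forall (I : set R) (c : R -> M),
    open I -> is_interval I -> I 0 ->
    (forall t, I t -> has_velocity c t (X (c t))) ->
    forall t, I t -> D (t, c 0) /\ Phi t (c 0) = c t
}.

Record lieGroup (R : realType) (d : nat) := LieGroup {
  gmanifold :> manifold R d;
  gmul : gmanifold -> gmanifold -> gmanifold;
  gone : gmanifold;
  ginv : gmanifold -> gmanifold;
  gmulA : forall g h k, gmul g (gmul h k) = gmul (gmul g h) k;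
  gmul1 : forall g, gmul gone g = g;
  gmulV : forall g, gmul (ginv g) g = gone;
  gmul_smooth : smooth_map2 gmul;
  ginv_smooth : smooth_map ginv
}.

Arguments gone {R d} l.

(* The Lie algebra T_1 G is represented by 'rV[R]_d, and its dual by 'rV[R]_d
   through [pairing]. *)
Definition pairing (R : realType) (d : nat) (mu xi : 'rV[R]_d) : R :=
  (mu *m xi^T) 0 0.

Definition Ad (R : realType) (d : nat) (G : lieGroup R d) (g : G) :
    'rV[R]_d -> 'rV[R]_d :=
  tangent_map (fun h : G => gmul (gmul g h) (ginv g)) (gone G).

(* Ad^*_(g^-1) mu, that is xi |-> <mu, Ad_(g^-1) xi> *)
Definition coad (R : realType) (d : nat) (G : lieGroup R d) (g : G)
    (mu : 'rV[R]_d) : 'rV[R]_d :=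
  \row_i pairing mu (Ad (ginv g) (delta_mx 0 i)).

Record smooth_action (R : realType) (d n : nat) (G : lieGroup R d)
    (P : manifold R n) (act : G -> P -> P) : Prop := SmoothAction {
  act_smooth : smooth_map2 act;
  act1 : forall p, act (gone G) p = p;
  actM : forall g h p, act (gmul g h) p = act g (act h p)
}.

Definition free_action (R : realType) (d n : nat) (G : lieGroup R d)
    (P : manifold R n) (act : G -> P -> P) : Prop :=
  forall g p, act g p = p -> g = gone G.

Definition proper_action (R : realType) (d n : nat) (G : lieGroup R d)
    (P : manifold R n) (act : G -> P -> P) : Prop :=
  forall K : set (P * P), compact K ->
    compact ((fun z : G * P => (act z.1 z.2, z.2)) @^-1` K).

Definition symplectic_action (R : realType) (d n : nat) (G : lieGroup R d)
    (P : manifold R n) (omega : P -> 'M[R]_n) (act : G -> P -> P) : Prop :=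
  forall g p v w,
    bil (omega (act g p)) (tangent_map (act g) p v) (tangent_map (act g) p w)
    = bil (omega p) v w.

(* the vector xi p tangent to the orbit of p *)
Definition inf_action (R : realType) (d n : nat) (G : lieGroup R d)
    (P : manifold R n) (act : G -> P -> P) (xi : 'rV[R]_d) (p : P) :
    'rV[R]_n :=
  tangent_map (act^~ p : G -> P) (gone G) xi.

Record equivariant_momentum_map (R : realType) (d n : nat) (G : lieGroup R d)
    (P : manifold R n) (omega : P -> 'M[R]_n) (act : G -> P -> P)
    (J : P -> 'rV[R]_d) : Prop := EquivariantMomentumMap {
  momentum_smooth : smooth_fun J;
  momentum_hamiltonian : forall xi,
    hamiltonian_field omega (fun p => pairing (J p) xi) (inf_action act xi);
  momentum_equivariant : forall g p, J (act g p) = coad g (J p)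
}.

Definition invariant_fun (R : realType) (d n : nat) (G : lieGroup R d)
    (P : manifold R n) (act : G -> P -> P) (Y : Type) (f : P -> Y) : Prop :=
  forall g p, f (act g p) = f p.

(* [kerquot f] is the quotient of T by the relation f x = f y, with the quotient
   topology. *)
Definition ker_rel (T : choiceType) (Y : Type) (f : T -> Y) : rel T :=
  fun x y => `[< f x = f y >].

Lemma ker_rel_equiv (T : choiceType) (Y : Type) (f : T -> Y) :
  equiv_class_of (ker_rel f).
Proof.
split=> [x|x y|y x z]; first exact/asboolP.
  by apply/asboolP/asboolP => ->.
by move=> /asboolP xy /asboolP yz; apply/asboolP; rewrite xy.
Qed.

Canonical ker_equiv (T : choiceType) (Y : Type) (f : T -> Y) :=
  EquivRelPack (ker_rel_equiv f).

Definition kerquot (T : topologicalType) (Y : Type) (f : T -> Y) :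
    topologicalType :=
  quotient_topology {eq_quot ker_equiv f}%qT.

Definition kerproj (T : topologicalType) (Y : Type) (f : T -> Y) (x : T) :
    kerquot f :=
  (\pi_(quotient_topology {eq_quot ker_equiv f}) x)%qT.

(* the injection induced by f *)
Definition kerlift (T : topologicalType) (Y : Type) (f : T -> Y)
    (q : kerquot f) : Y :=
  f (repr (q : quotient_topology {eq_quot ker_equiv f}%qT)).

Definition orbit (R : realType) (d n : nat) (G : lieGroup R d)
    (P : manifold R n) (act : G -> P -> P) (p : P) : set P :=
  range (act^~ p).

Definition orbit_space (R : realType) (d n : nat) (G : lieGroup R d)
    (P : manifold R n) (act : G -> P -> P) : topologicalType :=
  kerquot (orbit act).

Definition orbit_proj (R : realType) (d n : nat) (G : lieGroup R d)
    (P : manifold R n) (act : G -> P -> P) : P -> orbit_space act :=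
  @kerproj P _ (orbit act).

Definition orbit_tangent (R : realType) (d n : nat) (G : lieGroup R d)
    (P : manifold R n) (act : G -> P -> P) (p : P) : set 'rV[R]_n :=
  range (fun xi => inf_action act xi p).

(* P/G carries the smooth structure that makes the projection a submersion, so
   a map defined on an open subset of P/G is smooth iff its composite with the
   projection is.  Hence [slice_diffeo] says that the (smooth) restriction of
   the projection to S has a smooth inverse sigma. *)
Record is_slice (R : realType) (d n : nat) (G : lieGroup R d)
    (P : manifold R n) (act : G -> P -> P) (p : P) (S : set P) : Prop :=
  IsSlice {
  slice_submanifold : submanifold S;
  slice_mem : S p;
  slice_sum : forall v, exists a b,
    [/\ orbit_tangent act p a, tangent_space S p b & v = a + b];
  slice_direct : orbit_tangent act p `&` tangent_space S p = [set 0];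
  slice_open : open (orbit_proj act @` S);
  slice_diffeo : exists2 sigma : orbit_space act -> P,
    (forall s, S s -> sigma (orbit_proj act s) = s) &
    smooth_on (orbit_proj act @^-1` (orbit_proj act @` S))
              (sigma \o orbit_proj act)
}.

(* [kerquot orb] is G/G_mu, whose topology is the manifold topology of
   the coadjoint orbit of mu; it can be finer than the subspace topology. *)
Definition leaf (R : realType) (d : nat) (G : lieGroup R d)
    (U : set 'rV[R]_d) (mu : 'rV[R]_d) : set 'rV[R]_d :=
  let orb (g : G) := coad g mu in
  @kerlift G _ orb @`
    connected_component (@kerlift G _ orb @^-1` U) (@kerproj G _ orb (gone G)).

Definition leaf_space (R : realType) (d : nat) (G : lieGroup R d)
    (U : set 'rV[R]_d) : topologicalType :=
  @kerquot (set_type U) _ (fun mu => leaf G U (set_val mu)).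

Definition leaf_proj (R : realType) (d : nat) (G : lieGroup R d)
    (U : set 'rV[R]_d) : set_type U -> leaf_space G U :=
  @kerproj (set_type U) _ (fun mu => leaf G U (set_val mu)).

(* [cluster (nbhs y)]: the y' all of whose neighbourhoods meet all the
   neighbourhoods of y *)
Definition T2 (Y : topologicalType) (y : Y) : set Y := cluster (nbhs y).

Definition T2_leaf (R : realType) (d : nat) (G : lieGroup R d)
    (U : set 'rV[R]_d) (mu : 'rV[R]_d) : set 'rV[R]_d :=
  [set nu | exists x y : set_type U,
    [/\ set_val x = mu, set_val y = nu &
        T2 (leaf_proj G x) (leaf_proj G y)]].

Definition relative_equilibrium (R : realType) (d n : nat) (G : lieGroup R d)
    (P : manifold R n) (act : G -> P -> P) (X : P -> 'rV[R]_n) (p : P) : Prop :=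
  exists xi, X p = inf_action act xi p.

(* The clause D (t, q) makes explicit that Phi t q is defined for all t when q
   is close enough to p. *)
Definition G_stable (R : realType) (d n : nat) (G : lieGroup R d)
    (P : manifold R n) (act : G -> P -> P) (D : set (R * P))
    (Phi : R -> P -> P) (p : P) : Prop :=
  forall U : set P, nbhs p U -> (forall g q, U q -> U (act g q)) ->
  exists2 V : set P, nbhs p V &
    forall q, V q -> forall t, D (t, q) /\ U (Phi t q).

Definition conserved (R : realType) (n : nat) (P : manifold R n)
    (D : set (R * P)) (Phi : R -> P -> P) (Y : topologicalType) (f : P -> Y) :
    Prop :=
  continuous f /\ forall t p, D (t, p) -> f (Phi t p) = f p.

Definition isolating (R : realType) (d n : nat) (G : lieGroup R d)
    (P : manifold R n) (J : P -> 'rV[R]_d) (S : set P) (p : P) (Y : Type)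
    (f : P -> Y) : Prop :=
  exists (US : set P) (Umu : set 'rV[R]_d),
    [/\ US p, (exists2 O : set P, open O & US = O `&` S),
        Umu (J p), open Umu &
        f @^-1` [set f p] `&` J @^-1` T2_leaf G Umu (J p) `&` US = [set p]].

(* Main.v *)
Require Import Defs.
From mathcomp Require Import all_boot all_order all_algebra.
From mathcomp Require Import all_classical all_reals all_analysis.
Set Implicit Arguments.
Unset Strict Implicit.
Unset Printing Implicit Defensive.
Import Order.TTheory GRing.Theory Num.Theory.
Import numFieldNormedType.Exports.
Local Open Scope classical_set_scope.
Local Open Scope ring_scope.

(** Everything takes place in the slice.  The projection to the orbit space has
    a continuous local section with values in [S] ([slice_section]), so that
    every orbit near that of [pe] has a representative [s p] in [S].  Choose a
    compact neighbourhood [K] of [pe] in [S], so small that it lies in the given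
    [G]-invariant neighbourhood of [pe], in [US] and in the preimage of [Umu].
    It suffices that the representative of a trajectory that starts near [pe]
    never leaves [K] through its frontier [B].

    Follow such a trajectory until its representative reaches some [b] in [B].
    Two quantities have kept their values on the way.  The first is [f], which
    is conserved and invariant.  The second is the symplectic leaf, in [Umu], of
    the momentum of the representative: by Noether's theorem
    ([momentum_conserved]) the momentum is constant along the trajectory itself,
    so by equivariance the momentum of the representative moves along one
    coadjoint orbit; it moves continuously for the manifold topology of that
    orbit, because the group element carrying the trajectory to its
    representative depends continuously on time ([translation_cvg], as the action
    is free and proper); and it stays in [Umu], because the representative stays
    in [K].  This is [leaf_translated_path].

    On the other hand [b <> pe], so the isolating condition gives [f b <> f pe]
    or puts [J b] outside the [T2] set of the leaf of [J pe].  In the first case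
    Hausdorffness of the target, in the second the definition of [T2], yields
    neighbourhoods of [b] and of [pe] such that no point of the one has both its
    value of [f] and its leaf in common with a point of the other
    ([separated_from_equilibrium]).  As [B] is compact, one neighbourhood of [pe]
    serves for all [b] in [B], and trajectories starting there are trapped.

    Trapped trajectories exist for all times although [G K] need not be compact:
    [X_H] is equivariant ([hamiltonian_field_equivariant]), so a lower bound on
    the life time that is uniform on [K] is uniform on [G K]
    ([flow_complete_of_cocompact]). *)

(** * Differentiation in charts *)

(** A function of a chart is often known only near the point considered, as an
    inverse chart is meaningful only on its image. *)
Lemma near_eq_diff (R : realType) (V W : normedModType R) (f g : V -> W)
    (x : V) : (\forall y \near x, f y = g y) -> differentiable f x ->
  differentiable g x /\ ('d g x : V -> W) = 'd f x.
Proof.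
move=> fg df; have [dfc dfo] := (diff_locallyP x f).1 df.
have go : g \o shift x = cst (g x) + 'd f x +o_ 0 id.
  apply/eqaddoP => e e0; move/eqaddoP : dfo => /(_ e e0).
  have := fg; rewrite (near_shift 0) subr0 => fg0.
  apply: filterS2 fg0 => h /= fgh; rewrite !fctE /= fgh.
  by rewrite (nbhs_singleton fg).
have dgE := diff_unique dfc go.
split; last exact: dgE.
by apply: (diff_locallyP x g).2; rewrite dgE; split; [exact: dfc|exact: go].
Qed.

Lemma diff_curve (R : realType) (V W : normedModType R) (f : V -> W)
    (c : R -> V) (t : R) (v : V) :
  is_derive t 1 c v -> differentiable f (c t) ->
  is_derive t 1 (f \o c) ('d f (c t) v).
Proof.
move=> [dc cv] df.
have dct : differentiable c t by apply/derivable1_diffP.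
split; first by apply/derivable1_diffP/differentiable_comp.
rewrite deriveE; last exact/differentiable_comp.
by rewrite diff_comp //= -cv deriveE.
Qed.

Definition chart_differentiable (R : realType) (n : nat) (M : manifold R n)
    (V : normedModType R) (h : M -> V) (x : M) : Prop :=
  differentiable (h \o cinv (chart_at x)) (chart_at x x).

Definition map_differentiable (R : realType) (m n : nat) (M : manifold R m)
    (N : manifold R n) (f : M -> N) (x : M) : Prop :=
  {for x, continuous f} /\ chart_differentiable (chart_at (f x) \o f) x.

(** The chain rule on manifolds.  It holds because the transition through the
    chart at [f x] cancels near the point: by continuity [f] maps a
    neighbourhood of [x] into the domain of that chart. *)
Lemma chart_diff_comp (R : realType) (m n : nat) (M : manifold R m)
    (N : manifold R n) (V : normedModType R) (f : M -> N) (h : N -> V) (x : M) :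
  map_differentiable f x -> chart_differentiable h (f x) ->
  chart_differentiable (h \o f) x /\
  ('d (h \o f \o cinv (chart_at x)) (chart_at x x) : _ -> _) =
  'd (h \o cinv (chart_at (f x))) (chart_at (f x) (f x)) \o tangent_map f x.
Proof.
move=> [fc df] dh; set c := chart_at x; set e := chart_at (f x).
have cxK : cinv c (c x) = x by apply/cmapK/chart_at_dom.
have ex : (e \o f \o cinv c) (c x) = e (f x) by rewrite /= cxK.
have near_c : \forall u \near c x, cdom e (f (cinv c u)).
  have : {for c x, continuous (f \o cinv c)}.
    apply: continuous_comp; last by rewrite cxK.
    exact/cinv_continuous/cmap_img/chart_at_dom.
  apply; rewrite /= cxK; apply: open_nbhs_nbhs.
  by split; [exact: cdom_open|exact: chart_at_dom].
have feq : \forall u \near c x,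
    ((h \o cinv e) \o (e \o f \o cinv c)) u = (h \o f \o cinv c) u.
  by apply: filterS near_c => u du /=; rewrite cmapK.
have dg : differentiable (h \o cinv e) ((e \o f \o cinv c) (c x)).
  rewrite ex; exact: dh.
have [d1 d2] := near_eq_diff feq (differentiable_comp df dg).
by split; [exact: d1|rewrite d2 (diff_comp df dg) ex].
Qed.

Lemma velocity_comp (R : realType) (n : nat) (M : manifold R n)
    (V : normedModType R) (c : R -> M) (t : R) (v : 'rV[R]_n) (h : M -> V) :
  has_velocity c t v -> chart_differentiable h (c t) ->
  is_derive t 1 (h \o c) ('d (h \o cinv (chart_at (c t)))
    (chart_at (c t) (c t)) v).
Proof.
move=> [cc dc] dh; set e := chart_at (c t).
have := diff_curve (c := fun s => e (c s)) dc dh.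
apply: near_eq_is_derive.
have : \forall s \near t, cdom e (c s).
  apply: cc; apply: open_nbhs_nbhs.
  by split; [exact: cdom_open|exact: chart_at_dom].
by apply: filterS => s ds /=; rewrite cmapK.
Qed.

Lemma velocity_map (R : realType) (m n : nat) (M : manifold R m)
    (N : manifold R n) (c : R -> M) (t : R) (v : 'rV[R]_m) (f : M -> N) :
  has_velocity c t v -> map_differentiable f (c t) ->
  has_velocity (f \o c) t (tangent_map f (c t) v).
Proof.
move=> cv [fc df]; split; first by case: cv => cc _; exact: continuous_comp.
exact: (velocity_comp cv df).
Qed.

Lemma tangent_map_comp (R : realType) (m n k : nat) (M : manifold R m)
    (N : manifold R n) (K : manifold R k) (f : M -> N) (g : N -> K) (x : M) :
  map_differentiable f x -> map_differentiable g (f x) ->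
  tangent_map (g \o f) x = tangent_map g (f x) \o tangent_map f x.
Proof. by move=> df [gc dg]; have [] := chart_diff_comp df dg. Qed.

Lemma smooth_chart_differentiable (R : realType) (n : nat) (M : manifold R n)
    (V : normedModType R) (h : M -> V) (x : M) :
  smooth_fun h -> chart_differentiable h x.
Proof.
move=> hs; have [dh _] := hs _ (chart_at_atlas x) 1%N.
exact/dh/cmap_img/chart_at_dom.
Qed.

Lemma chart_differentiable_continuous (R : realType) (n : nat)
    (M : manifold R n) (V : normedModType R) (h : M -> V) (x : M) :
  chart_differentiable h x -> {for x, continuous h}.
Proof.
move=> /differentiable_continuous dh; set c := chart_at x.
have : {for x, continuous ((h \o cinv c) \o c)}.
  by apply: continuous_comp => //; exact/cmap_continuous/chart_at_dom.
rewrite /prop_for /continuous_at /= cmapK; last exact: chart_at_dom.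
apply: cvg_trans; apply: near_eq_cvg.
have : \forall y \near x, cdom c y.
  apply: open_nbhs_nbhs.
  by split; [exact: cdom_open|exact: chart_at_dom].
by apply: filterS => y dy /=; rewrite cmapK.
Qed.

(** Joint smoothness in product charts gives differentiability in each variable,
    by restriction to an affine slice of the product of the charts. *)
Section Partial.
Variables (R : realType) (m n k : nat) (M : manifold R m) (N : manifold R n).
Variables (K : manifold R k) (f : M -> N -> K).
Hypothesis fs : smooth_map2 f.

Let product_chart_diff (x : M) (y : N) :
  differentiable (fun u : 'rV[R]_m * 'rV[R]_n =>
     chart_at (f x y) (f (cinv (chart_at x) u.1) (cinv (chart_at y) u.2)))
    (chart_at x x, chart_at y y).
Proof.
have [_ /(_ _ _ _ (chart_at_atlas x) (chart_at_atlas y)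
  (chart_at_atlas (f x y)) 1%N) [+ _]] := fs.
apply; split; rewrite /= ?cmapK; by [exact/cmap_img/chart_at_dom|
  exact: chart_at_dom].
Qed.

Lemma partial_map_differentiable_l (x : M) (y : N) :
  map_differentiable (f^~ y) x.
Proof.
split.
  have [fc _] := fs; apply: (@continuous_comp _ _ _ (fun z => (z, y))
    (fun z => f z.1 z.2)); last exact: fc.
  by apply: cvg_pair => //; exact: cvg_cst.
have d : differentiable (fun u : 'rV[R]_m => (u, chart_at y y)) (chart_at x x).
  exact: differentiable_pair.
have := differentiable_comp d (product_chart_diff x y).
rewrite /comp /= /chart_differentiable /comp cmapK //; exact: chart_at_dom.
Qed.

Lemma partial_map_differentiable_r (x : M) (y : N) :
  map_differentiable (f x) y.
Proof.
split.
  have [fc _] := fs; apply: (@continuous_comp _ _ _ (fun z => (x, z))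
    (fun z => f z.1 z.2)); last exact: fc.
  by apply: cvg_pair => //; exact: cvg_cst.
have d : differentiable (fun u : 'rV[R]_n => (chart_at x x, u)) (chart_at y y).
  exact: differentiable_pair.
have := differentiable_comp d (product_chart_diff x y).
rewrite /comp /= /chart_differentiable /comp cmapK //; exact: chart_at_dom.
Qed.

End Partial.

(** * Invariant Hamiltonian systems *)

Lemma is_derive0_interval (R : realType) (f : R -> R) (I : set R) :
  is_interval I -> (forall t, I t -> is_derive t 1 f 0) ->
  forall a b, I a -> I b -> f a = f b.
Proof.
move=> iI df a b; wlog ab : a b / a <= b => [W Ia Ib|Ia Ib].
  by case: (leP a b) => [/W|/ltW/W ->] //; exact.
have II x : x \in `[a, b]%R -> I x by rewrite in_itv /= => /iI; exact.
have [x xab||c _] := @MVT_segment R f (fun=> 0) a b ab.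
- by apply: df; apply: II; exact: subset_itv_oo_cc xab.
- apply: derivable_within_continuous => x /II /df dx; exact: ex_derive.
- by rewrite mul0r => /eqP; rewrite subr_eq0 => /eqP.
Qed.

Section Bilinear.
Variables (R : realType) (n : nat) (A : 'M[R]_n).

Lemma bilDl (u v w : 'rV[R]_n) : bil A (u + v) w = bil A u w + bil A v w.
Proof. by rewrite /bil !mulmxDl mxE. Qed.

Lemma bilDr (u v w : 'rV[R]_n) : bil A u (v + w) = bil A u v + bil A u w.
Proof. by rewrite /bil linearD /= mulmxDr mxE. Qed.

Lemma bilBl (u v w : 'rV[R]_n) : bil A (u - v) w = bil A u w - bil A v w.
Proof. by rewrite /bil !mulmxBl !mxE. Qed.

Lemma bil_antisym : (forall v, bil A v v = 0) ->
  forall v w, bil A v w = - bil A w v.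
Proof.
move=> alt v w; apply/eqP; rewrite -addr_eq0; apply/eqP.
have := alt (v + w).
by rewrite bilDl !bilDr !alt add0r addr0.
Qed.

End Bilinear.

Section Mechanics.
Variables (R : realType) (n d : nat) (P : manifold R n) (omega : P -> 'M[R]_n).
Variables (G : lieGroup R d) (act : G -> P -> P).
Hypothesis act_smth : smooth_action act.

Lemma act_differentiable (g : G) (p : P) : map_differentiable (act g) p.
Proof. exact: (partial_map_differentiable_r (act_smooth act_smth)). Qed.

Lemma orbit_map_differentiable (g : G) (p : P) :
  map_differentiable (act^~ p : G -> P) g.
Proof. exact: (partial_map_differentiable_l (act_smooth act_smth)). Qed.

Lemma act_gmulV (g : G) (p : P) : act (ginv g) (act g p) = p.
Proof. by rewrite -(actM act_smth) gmulV (act1 act_smth). Qed.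

Lemma gmulgV (g : G) : gmul g (ginv g) = gone G.
Proof.
have e := gmulV (ginv g).
by rewrite -[gmul g _]gmul1 -{1}e -gmulA [gmul _ (gmul g _)]gmulA gmulV gmul1.
Qed.

Lemma gmulg1 (g : G) : gmul g (gone G) = g.
Proof. by rewrite -(gmulV g) gmulA gmulgV gmul1. Qed.

Lemma act_gmulgV (g : G) (p : P) : act g (act (ginv g) p) = p.
Proof. by rewrite -(actM act_smth) gmulgV (act1 act_smth). Qed.

(** The chain rule for [act g \o act (ginv g) = id]. *)
Lemma tangent_act_surjective (g : G) (p : P) (w : 'rV[R]_n) :
  exists v, tangent_map (act g) p v = w.
Proof.
set q := act g p; have qE : act (ginv g) q = p by exact: act_gmulV.
exists (tangent_map (act (ginv g)) q w).
have dg : map_differentiable (act g) (act (ginv g) q).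
  exact: act_differentiable.
have e := tangent_map_comp (act_differentiable (ginv g) q) dg.
rewrite -[in LHS]qE; transitivity (tangent_map (act g \o act (ginv g)) q w).
  by rewrite e.
have -> : act g \o act (ginv g) = idfun by apply/funext => x; exact: act_gmulgV.
have near_id : \forall u \near chart_at q q,
    idfun u = (chart_at q \o cinv (chart_at q)) u.
  have : nbhs (chart_at q q) (cimg (chart_at q)).
    apply: open_nbhs_nbhs.
    by split; [exact: cimg_open|exact/cmap_img/chart_at_dom].
  by apply: filterS => u du /=; rewrite cinvK.
have [|_ e'] := near_eq_diff near_id; first exact: ex_diff.
by transitivity ('d idfun (chart_at q q) w); [rewrite -e'|rewrite diff_val].
Qed.

(** [h] is constant along the orbit map [g |-> act g p], whose tangent map at the
    identity is [inf_action]. *)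
Lemma differential_inf_action (h : P -> R) (p : P) (xi : 'rV[R]_d) :
  chart_differentiable h p -> invariant_fun act h ->
  differential h p (inf_action act xi p) = 0.
Proof.
move=> dh hinv.
have dh1 : chart_differentiable h (act (gone G) p) by rewrite (act1 act_smth).
have [_ e] := chart_diff_comp (orbit_map_differentiable (gone G) p) dh1.
transitivity (differential h (act (gone G) p) (inf_action act xi p)).
  by rewrite (act1 act_smth).
transitivity (differential (h \o act^~ p) (gone G) xi).
  by rewrite /differential e.
have -> : h \o act^~ p = cst (h p) by apply/funext => g; exact: hinv.
rewrite /differential.
have -> : cst (h p) \o cinv (chart_at (gone G)) = cst (h p) by [].
by rewrite diff_cst.
Qed.

Hypothesis omega_sympl : symplectic_form omega.

(** Both sides have the same product by [omega] with every vector: such a vector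
    is the image [w] of some [v] under the tangent map of [act g], and both
    products equal [dH] at [p] applied to [v], by invariance of [omega] and of
    [H]. *)
Lemma hamiltonian_field_equivariant (H : P -> R) (X : P -> 'rV[R]_n) :
  symplectic_action omega act -> (forall p, chart_differentiable H p) ->
  invariant_fun act H -> hamiltonian_field omega H X ->
  forall g p, X (act g p) = tangent_map (act g) p (X p).
Proof.
move=> act_sympl dH Hinv XH g p; apply/subr0_eq.
apply: (form_nondegenerate omega_sympl (p := act g p)) => w.
have [v <-] := tangent_act_surjective g p w.
rewrite bilBl act_sympl !XH.
have HE : H \o act g = H by apply/funext => q; exact: Hinv.
have [_ e] := chart_diff_comp (act_differentiable g p) (dH (act g p)).
rewrite HE in e.
rewrite [differential H p v](congr1 (fun F : _ -> _ => F v) e).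
by apply/eqP; rewrite subr_eq0.
Qed.

End Mechanics.

(** * Maximal flows *)

Section Flow.
Variables (R : realType) (n : nat) (P : manifold R n) (X : P -> 'rV[R]_n).
Variables (D : set (R * P)) (Phi : R -> P -> P).
Hypothesis flowX : is_flow X D Phi.

Lemma flow_time_open (p : P) : open [set t | D (t, p)].
Proof.
have c : continuous (fun t : R => (t, p)).
  by move=> t; exact: (cvg_pair (@cvg_id _ (nbhs t)) (cvg_cst p)).
by move/continuousP : c => /(_ D (flow_open flowX)).
Qed.

Lemma flow_curve_continuous (p : P) (t : R) :
  D (t, p) -> {for t, continuous (Phi^~ p)}.
Proof. by move=> Dt; have [] := flow_integral flowX Dt. Qed.

Lemma has_velocity_shift (c : R -> P) (a t : R) (v : 'rV[R]_n) :
  has_velocity c (t + a) v -> has_velocity (fun s => c (s + a)) t v.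
Proof.
move=> [cc [dc cv]].
have ds : is_derive t 1 (fun s : R => s + a) (1 : R) by exact: is_derive_shift.
split.
  apply: (@continuous_comp _ _ _ (fun s => s + a) c) => //.
  apply: differentiable_continuous.
  by apply/derivable1_diffP; case: ds.
have df : differentiable (fun s => chart_at (c (t + a)) (c s)) (t + a).
  exact/derivable1_diffP.
have dE := deriveE (1 : R) df; rewrite cv in dE; rewrite dE.
exact: (diff_curve ds df).
Qed.

(** Uniqueness of integral curves enters only through the maximality of the
    flow.  It is used twice: along the orbit of [p] started at [Phi t p], to see
    that this orbit comes back to [p] at time [- t]; then along the orbit of
    [Phi t p] started at [p].  In this way no curves have to be glued. *)
Lemma flow_domain_add (p : P) (s t : R) :
  D (t, p) -> D (s, Phi t p) -> D (s + t, p).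
Proof.
move=> Dt Ds.
(* the time interval of [p] seen from [Phi t p]: it reaches back to time [-t] *)
have [Dm Phim] : D (- t, Phi t p) /\ Phi (- t) (Phi t p) = p.
  have := flow_maximal flowX (I := [set r | D (r + t, p)])
    (c := fun r => Phi (r + t) p).
  move=> /(_ _ _ _ _ (- t)) /=; rewrite add0r addNr (flow0 flowX); apply.
  - have c : continuous (fun r : R => r + t).
      by move=> r; apply: cvgD => //; exact: cvg_cst.
    by move/continuousP : c => /(_ _ (@flow_time_open p)).
  - move=> x y Dx Dy z /andP[xz zy]; apply: (flow_interval flowX Dx Dy).
    by rewrite !lerD2r xz zy.
  - exact: Dt.
  - move=> r Dr; have := flow_integral flowX Dr.
    exact: (@has_velocity_shift (Phi^~ p)).
  - exact: flow_dom0 flowX p.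
have := flow_maximal flowX (I := [set r | D (r - t, Phi t p)])
  (c := fun r => Phi (r - t) (Phi t p)).
move=> /(_ _ _ _ _ (s + t)) /=; rewrite add0r Phim addrK => H.
apply: (H _ _ _ _ Ds).1.
- have c : continuous (fun r : R => r - t).
    by move=> r; apply: cvgB => //; exact: cvg_cst.
  by move/continuousP : c => /(_ _ (@flow_time_open (Phi t p))).
- move=> x y Dx Dy z /andP[xz zy]; apply: (flow_interval flowX Dx Dy).
  by rewrite !lerD2r xz zy.
- exact: Dm.
- move=> r Dr; have := flow_integral flowX Dr.
  exact: (@has_velocity_shift (Phi^~ (Phi t p))).
Qed.

Lemma flow_conserved (h : P -> R) :
  (forall p, chart_differentiable h p) ->
  (forall p, differential h p (X p) = 0) ->
  conserved D Phi h.
Proof.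
move=> dh hX; split=> [p|t p Dt].
  exact: chart_differentiable_continuous.
rewrite -{2}(flow0 flowX p).
have hD s : D (s, p) -> is_derive s 1 (h \o Phi^~ p) 0.
  move=> Ds; rewrite -(hX (Phi s p)).
  exact: (velocity_comp (flow_integral flowX Ds) (dh (Phi s p))).
exact: (is_derive0_interval (flow_interval flowX (p := p)) hD Dt
  (flow_dom0 flowX p)).
Qed.

Variables (d : nat) (G : lieGroup R d) (act : G -> P -> P).
Hypothesis act_smth : smooth_action act.
Hypothesis X_equiv : forall g p, X (act g p) = tangent_map (act g) p (X p).

(** The translate by [g] of an integral curve is an integral curve. *)
Lemma flow_domain_invariant (g : G) (t : R) (p : P) :
  D (t, p) -> D (t, act g p).
Proof.
move=> Dt.
have := flow_maximal flowX (I := [set s | D (s, p)])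
  (c := fun s => act g (Phi s p)).
move=> /(_ _ _ _ _ t Dt); rewrite (flow0 flowX) => H; apply: (H _ _ _ _).1.
- exact: flow_time_open.
- exact: (flow_interval flowX).
- exact: flow_dom0 flowX p.
- move=> s Ds; rewrite X_equiv.
  exact: (velocity_map (flow_integral flowX Ds)
    (act_differentiable act_smth g _)).
Qed.

(** The escape lemma modulo the group.  By compactness all points of [K] live at
    least for a common time [e], and by invariance of the domain so do all points
    of [G K].  Hence a trajectory in [G K] can always be continued by [e]. *)
Lemma flow_complete_of_cocompact (K : set P) (p : P) : compact K ->
  (forall t, D (t, p) -> exists g, K (act g (Phi t p))) ->
  forall t, D (t, p).
Proof.
move=> Kc trap.
have [e e0 De] : exists2 e : R, 0 < e &
    forall q t, K q -> `|t| <= e -> D (t, q).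
  have /compact_near_coveringP /(_ R (nbhs (0 : R)) (fun t q => D (t, q))) := Kc.
  case=> [q _|e /= e0 De].
    have : nbhs ((0 : R), q) D.
      apply: open_nbhs_nbhs; split; first exact: flow_open flowX.
      exact: flow_dom0 flowX q.
    move=> [[A B] /= [A0 Bq] AB]; exists (B, A) => //= z [Bz Az].
    exact: (AB (z.2, z.1)).
  exists (e / 2); first by rewrite divr_gt0.
  move=> q t Kq te; apply: (De t) => //=.
  by rewrite sub0r normrN (le_lt_trans te) // ltr_pdivrMr // ltr_pMr // ltr1n.
have De' t s : D (t, p) -> `|s| <= e -> D (s + t, p).
  move=> Dt se; apply: flow_domain_add => //; have [g Kg] := trap t Dt.
  by rewrite -[Phi t p](act_gmulV act_smth g); exact/flow_domain_invariant/De.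
have Dn (s : R) (k : nat) : `|s| <= e -> D (s *+ k, p).
  move=> se; elim: k => [|k IH].
    by rewrite mulr0n; exact: flow_dom0 flowX p.
  by rewrite mulrS; exact: De'.
move=> t; pose k := (Num.truncn (`|t| / e)).+1.
have k0 : (0 : R) < k%:R by rewrite ltr0n.
have -> : t = (t / k%:R) *+ k by rewrite -mulr_natr divfK // gt_eqF.
apply: Dn; rewrite normrM normfV (gtr0_norm k0) ler_pdivrMr // mulrC.
by rewrite -ler_pdivrMr // ltW // truncnS_gt.
Qed.

End Flow.

(** * Noether's theorem *)

Section Noether.
Variables (R : realType) (n d : nat) (P : manifold R n) (omega : P -> 'M[R]_n).
Variables (G : lieGroup R d) (act : G -> P -> P).
Hypotheses (omega_sympl : symplectic_form omega) (act_smth : smooth_action act).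
Variables (H : P -> R) (X : P -> 'rV[R]_n).
Hypotheses (H_smooth : smooth_fun H) (X_H : hamiltonian_field omega H X).
Variables (D : set (R * P)) (Phi : R -> P -> P).
Hypothesis flowX : is_flow X D Phi.

Lemma hamiltonian_conserved : conserved D Phi H.
Proof.
apply: (flow_conserved flowX) => p; first exact: smooth_chart_differentiable.
by rewrite -X_H; exact: form_alternating omega_sympl p _.
Qed.

(** Noether's theorem: the derivative of the component [xi] of [J] along [X] is
    [omega (inf_action xi) X = - dH (inf_action xi)], and [H] is invariant. *)
Lemma momentum_conserved (J : P -> 'rV[R]_d) :
  invariant_fun act H -> equivariant_momentum_map omega act J ->
  forall t p, D (t, p) -> J (Phi t p) = J p.
Proof.
move=> H_inv J_mom t p Dt; apply/rowP => i.
pose xi : 'rV[R]_d := delta_mx 0 i.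
have pairE : (fun p => pairing (J p) xi) = (fun p => J p 0 i).
  apply/funext => q; rewrite /pairing /xi trmx_delta -colE.
  by rewrite mxE.
have [_ ->//] : conserved D Phi (fun q => J q 0 i).
apply: (flow_conserved flowX) => q.
  have dJ := smooth_chart_differentiable q (momentum_smooth J_mom).
  exact: (differentiable_comp dJ (differentiable_coord _ 0 i)).
have := momentum_hamiltonian J_mom xi q (X q); rewrite pairE => <-.
rewrite (bil_antisym (form_alternating omega_sympl q)) X_H.
rewrite (differential_inf_action act_smth) ?oppr0 //.
exact: smooth_chart_differentiable.
Qed.

End Noether.

(** * Topological preliminaries *)

(** The infimum of the points where [Q] fails would satisfy [Q], by the first
    hypothesis, and be isolated from the failures, by the second. *)
Lemma real_induction (R : realType) (a b : R) (Q : R -> Prop) :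
  (forall t, a <= t <= b -> (forall r, a <= r < t -> Q r) -> Q t) ->
  (forall t, a <= t <= b -> Q t -> \forall r \near t, Q r) ->
  forall t, a <= t <= b -> Q t.
Proof.
move=> closedQ openQ t tab; apply: contrapT => nQt.
pose E := [set r | a <= r <= b /\ ~ Q r].
have Et : E t by [].
have Elb : lbound E a by move=> r [/andP[]].
have Einf : has_inf E by split; [exists t|exists a].
have ai : a <= inf E by apply: lb_le_inf => //; exists t.
have it : inf E <= t by apply: ge_inf => //; exists a.
have iab : a <= inf E <= b.
  by rewrite ai (le_trans it) //; case/andP: tab.
have Qi : Q (inf E).
  apply: closedQ => // r /andP[ar ri]; apply: contrapT => nQr.
  have : inf E <= r.
    apply: ge_inf; first by exists a.
    split => //; rewrite ar /=; apply: (le_trans (ltW ri)).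
    by case/andP: iab.
  by rewrite leNgt ri.
have /nbhs_ballP[e /= e0 be] := openQ _ iab Qi.
have /(_ _ e0) [r Er re] := inf_adherent _ Einf.
have ir : inf E <= r by apply: ge_inf => //; exists a.
case: Er => _; apply; apply: be.
by rewrite /ball /= distrC ger0_norm ?subr_ge0 // ltrBlDl.
Qed.

Lemma hausdorff_prod (S T : topologicalType) :
  hausdorff_space S -> hausdorff_space T -> hausdorff_space (S * T)%type.
Proof.
move=> hS hT [a b] [c d] /= cl; congr pair.
- apply: hS => A B Aa Bc.
  have [||[x y] [Ax Bx]] := cl (A `*` setT) (B `*` setT).
  + by exists (A, setT) => //=; split => //; exact: filterT.
  + by exists (B, setT) => //=; split => //; exact: filterT.
  + by exists x; split; [case: Ax|case: Bx].
- apply: hT => A B Ab Bd.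
  have [||[x y] [Ax Bx]] := cl (setT `*` A) (setT `*` B).
  + by exists (setT, A) => //=; split => //; exact: filterT.
  + by exists (setT, B) => //=; split => //; exact: filterT.
  + by exists y; split; [case: Ax|case: Bx].
Qed.

Lemma not_cluster_disjoint (T : topologicalType) (x y : T) :
  ~ cluster (nbhs x) y ->
  exists A B, [/\ nbhs x A, nbhs y B & A `&` B = set0].
Proof.
move=> ncl; apply: contrapT => nAB; apply: ncl => A B Ax By.
by apply/set0P/eqP => AB; apply: nAB; exists A, B.
Qed.

(** The image under an inverse chart of a small closed ball. *)
Lemma manifold_locally_compact (R : realType) (n : nat) (M : manifold R n)
    (x : M) (U : set M) :
  nbhs x U -> exists K, [/\ nbhs x K, compact K & K `<=` U].
Proof.
move=> Ux; set c := chart_at x; have dx : cdom c x by exact: chart_at_dom.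
have cx : cimg c (c x) by exact: cmap_img.
have : \forall u \near c x, cimg c u /\ U (cinv c u).
  apply: filterI; first by apply: open_nbhs_nbhs; split => //; exact: cimg_open.
  by apply: (cinv_continuous cx); rewrite cmapK.
move=> /(iffLR (nbhs_closedballP _ _)) [e eU].
exists (cinv c @` closed_ball (c x) e%:num); split.
- have : \forall y \near x, cdom c y /\ closed_ball (c x) e%:num (c y).
    apply: filterI; first by apply: open_nbhs_nbhs; split => //; exact: cdom_open.
    by apply: (cmap_continuous dx); apply/nbhs_closedballP; exists e.
  by apply: filterS => y [dy by_]; exists (c y) => //; rewrite cmapK.
- apply: continuous_compact.
    apply: continuous_in_subspaceT => u /[!inE] /eU [cu _].
    exact: cinv_continuous.
  apply: bounded_closed_compact; last exact: closed_ball_closed.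
  exists (`|c x| + e%:num); split=> [|B ltB u /=]; first exact: num_real.
  rewrite closed_ballE // /closed_ball_ /= => ue; apply: le_trans (ltW ltB).
  rewrite -[u](subrK (c x)) addrC (le_trans (ler_normD _ _)) // lerD2l.
  by rewrite distrC.
- by move=> _ [u /eU [_ Uu] <-].
Qed.

(** * Free and proper actions *)

Section ProperAction.
Variables (R : realType) (n d : nat) (P : manifold R n) (G : lieGroup R d).
Variable act : G -> P -> P.
Hypothesis act_smth : smooth_action act.
Hypothesis act_proper : proper_action act.

Let theta (z : G * P) : P * P := (act z.1 z.2, z.2).

(** A proper map to a locally compact Hausdorff space is closed: near a given
    point of the target, the image of [E] is the image of a compact part of
    [E]. *)
Lemma proper_action_closed_map (E : set (G * P)) :
  closed E -> closed (theta @` E).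
Proof.
move=> Ecl [a b] clE.
have [K [Ka Kc _]] := manifold_locally_compact (@filterT _ (nbhs a) _).
have [L [Lb Lc _]] := manifold_locally_compact (@filterT _ (nbhs b) _).
have theta_cont : continuous theta.
  move=> z; have [ac _] := act_smooth act_smth.
  exact: (cvg_pair (ac z) (@cvg_snd _ _ (nbhs z.1) (nbhs z.2) _)).
pose C := theta @` (theta @^-1` (K `*` L) `&` E).
have Cc : closed C.
  apply: compact_closed.
    by apply: hausdorff_prod; exact: manifold_hausdorff.
  apply: continuous_compact; first exact: continuous_subspaceT.
  by apply: compact_closedI => //; apply: act_proper; exact: compact_setX.
have : closure C (a, b).
  move=> W Wab; have KL : nbhs (a, b) (K `*` L) by exists (K, L).
  have [_ [[z Ez <-] [KLz Wz]]] := clE _ (filterI KL Wab).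
  by exists (theta z); split => //; exists z.
by move=> /Cc [z [_ Ez] zab]; exists z.
Qed.

(** The graph of the orbit relation is closed, so a point [p] with [~ K (act g p)]
    for all [g] has, for each [k] in [K], a neighbourhood of points whose orbits
    avoid a neighbourhood of [k]; [K] being compact, finitely many of these
    suffice. *)
Lemma saturation_closed (K : set P) :
  compact K -> closed [set p | exists g, K (act g p)].
Proof.
move=> Kc p clp; apply: contrapT => np.
have Cc : closed (range theta) by apply: proper_action_closed_map; exact: closedT.
have near_p : \forall q \near p, K `<=` (fun k => ~ range theta (k, q)).
  apply: ((compact_near_coveringP K).1 Kc) => k Kk.
  have nkp : ~ range theta (k, p).
    move=> [[g q] _] [/= e1 e2]; apply: np; exists g.
    by rewrite -e2 e1.
  have : nbhs (k, p) (~` range theta).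
    by apply: open_nbhs_nbhs; split => //; exact: closed_openC.
  move=> [[V W] /= [Vk Wp] VW]; exists (V, W) => // -[k' q] ?.
  exact: (VW (k', q)).
have [q [[g Kg] nq]] := clp _ near_p.
by apply: (nq _ Kg); exists (g, q).
Qed.

Hypothesis act_free : free_action act.

Lemma free_act_inj (p : P) : injective (act^~ p : G -> P).
Proof.
move=> g h e.
have e1 : act (gmul (ginv h) g) p = p.
  by rewrite (actM act_smth) e (act_gmulV act_smth).
have := act_free e1 => e2.
by rewrite -[g]gmul1 -(gmulgV h) -gmulA e2 gmulg1.
Qed.

(** In a free and proper action, the group element that carries [x] to [y] depends
    continuously on the pair [(x, y)] where it exists.  Otherwise the limit
    [(act g0 a0, a0)] would lie in the closed image of the pairs [(g, q)] with [g]
    outside a neighbourhood of [g0], against freeness. *)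
Lemma translation_cvg (I : Type) (F : set_system I) (FF : Filter F)
    (a b : I -> P) (gam : I -> G) (a0 : P) (g0 : G) :
  a @ F --> a0 -> b @ F --> act g0 a0 ->
  (\forall i \near F, b i = act (gam i) (a i)) -> gam @ F --> g0.
Proof.
move=> ca cb bE O; rewrite nbhsE => -[V [Vo Vg] VO].
pose E : set (G * P) := fst @^-1` (~` V).
have Ecl : closed (theta @` E).
  apply: proper_action_closed_map; apply: closed_comp (open_closedC Vo).
  by move=> z _; exact: cvg_fst.
have nE : ~ (theta @` E) (act g0 a0, a0).
  move=> [[g q] /= nV [e1 e2]]; apply: nV.
  by rewrite e2 in e1; rewrite (free_act_inj e1).
have notE : nbhs (act g0 a0, a0) (~` (theta @` E)).
  by apply: open_nbhs_nbhs; split => //; exact: closed_openC.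
apply: filterS2 bE (cvg_pair cb ca notE) => i bi nEi; apply: VO.
apply: contrapT => nV.
by apply: nEi; exists (gam i, a i) => //; rewrite /theta /= bi.
Qed.

End ProperAction.

(** * Symplectic leaves of the dual of the Lie algebra *)

Section KernelQuotient.
Variables (T : topologicalType) (Y : Type) (f : T -> Y).

Lemma kerproj_continuous : continuous (@kerproj T Y f).
Proof. exact: pi_continuous. Qed.

Lemma kerproj_eqP (x y : T) : kerproj f x = kerproj f y <-> f x = f y.
Proof.
by split=> [/eqmodP /asboolP|e] //; apply/eqmodP/asboolP.
Qed.

Lemma kerproj_repr (q : kerquot f) : kerproj f (repr q) = q.
Proof. exact: reprK. Qed.

Lemma kerlift_kerproj (x : T) : kerlift (kerproj f x) = f x.
Proof. by apply/kerproj_eqP; rewrite kerproj_repr. Qed.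

End KernelQuotient.

Lemma connected_component_image (T T' : topologicalType) (h : T -> T')
    (A : set T) (B : set T') (x : T) : continuous h -> A `<=` h @^-1` B ->
  h @` connected_component A x `<=` connected_component B (h x).
Proof.
move=> hc AB _ [y [C [Cx CA Cc] Cy] <-].
exists (h @` C); last by exists y.
split; [by exists x|by move=> _ [z /CA /AB Bz <-]|].
by apply: connected_continuous_connected => //; exact: continuous_subspaceT.
Qed.

(** [phi] descends to a continuous map of the quotients, which commutes with the
    induced injections and hence maps components to components. *)
Lemma kerlift_component_sub (T T' : topologicalType) (Y : Type) (f : T -> Y)
    (f' : T' -> Y) (phi : T -> T') (U : set Y) (x : T) :
  continuous phi -> (forall t, f' (phi t) = f t) ->
  @kerlift T Y f @` connected_component (@kerlift T Y f @^-1` U) (kerproj f x)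
  `<=` @kerlift T' Y f' @`
    connected_component (@kerlift T' Y f' @^-1` U) (kerproj f' (phi x)).
Proof.
move=> phic ff'.
pose psi (q : kerquot f) : kerquot f' := kerproj f' (phi (repr q)).
have psiE t : psi (kerproj f t) = kerproj f' (phi t).
  by apply/kerproj_eqP; rewrite !ff'; apply/kerproj_eqP; rewrite kerproj_repr.
have liftE q : kerlift (psi q) = kerlift q by rewrite kerlift_kerproj ff'.
have psic : continuous psi.
  suff : continuous (psi \o kerproj f) by move/quotient_continuous.
  have -> : psi \o kerproj f = kerproj f' \o phi.
    by apply/funext => t; exact: psiE.
  by move=> t; apply: continuous_comp; [exact: phic|exact: kerproj_continuous].
move=> _ [q qc <-]; exists (psi q); last exact: liftE.
rewrite -psiE.
apply: (connected_component_image (A := kerlift (f:=f) @^-1` U) psic).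
  by move=> r; rewrite /preimage /= liftE.
by exists q.
Qed.

Lemma set_type_nbhs (T : topologicalType) (A : set T) (x : set_type A)
    (N : set (set_type A)) :
  nbhs x N -> exists2 M, nbhs (set_val x) M & set_val @^-1` M `<=` N.
Proof.
move=> [V [[B Bo BV] Vx] VN]; exists B.
  have Bx : B (set_val x) by rewrite -BV in Vx.
  exact: (@open_nbhs_nbhs T (set_val x) B (conj Bo Bx)).
by rewrite BV.
Qed.

Section Leaves.
Variables (R : realType) (n d : nat) (P : manifold R n) (G : lieGroup R d).
Variable act : G -> P -> P.
Hypothesis act_smth : smooth_action act.
Variable J : P -> 'rV[R]_d.
Hypothesis J_equiv : forall g p, J (act g p) = coad g (J p).

Lemma gmulr_continuous (g : G) : continuous (fun h : G => gmul h g).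
Proof.
by move=> h; have [] := partial_map_differentiable_l (gmul_smooth G) h g.
Qed.

(** The leaf of [coad g (J p)] is defined through the quotient of [G] by the
    stabilizer of that momentum.  Right translation by [g] identifies this
    quotient with that by the stabilizer of [J p] and moves the base point from
    the identity to [g], so that the leaves of all momenta in one coadjoint orbit
    can be compared in a single space.  That [coad] is an action is read off from
    the equivariance of [J], which is why the momentum has the form [J p]. *)
Lemma leaf_coad (U : set 'rV[R]_d) (p : P) (g : G) :
  let orb (h : G) := coad h (J p) in
  leaf G U (coad g (J p)) = @kerlift G _ orb @`
    connected_component (@kerlift G _ orb @^-1` U) (kerproj orb g).
Proof.
move=> orb; rewrite eqEsubset; split.
- have := @kerlift_component_sub G G _ (fun h => coad h (coad g (J p))) orb
    (fun h => gmul h g) U (gone G) (@gmulr_continuous g).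
  rewrite gmul1; apply=> h.
  by rewrite /orb -!J_equiv (actM act_smth).
- have := @kerlift_component_sub G G _ orb (fun h => coad h (coad g (J p)))
    (fun h => gmul h (ginv g)) U g (@gmulr_continuous (ginv g)).
  rewrite gmulgV; apply=> h.
  by rewrite /orb -!J_equiv -!(actM act_smth) -gmulA gmulV gmulg1.
Qed.

(** The image of [Gam] in the quotient is connected and stays over [U], hence lies
    in one component. *)
Lemma leaf_coad_connected (U : set 'rV[R]_d) (p : P) (Gam : set G) :
  connected Gam -> (forall g, Gam g -> U (coad g (J p))) ->
  forall g h, Gam g -> Gam h ->
    leaf G U (coad g (J p)) = leaf G U (coad h (J p)).
Proof.
move=> Gc GU g h Gg Gh.
have e : connected_component
    (@kerlift G _ (fun h => coad h (J p)) @^-1` U) (kerproj _ g) =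
    connected_component
    (@kerlift G _ (fun h => coad h (J p)) @^-1` U) (kerproj _ h).
  apply: same_connected_component.
  exists (@kerproj G _ (fun h => coad h (J p)) @` Gam); last by exists h.
  split; first by exists g.
    by move=> _ [k /GU Uk <-]; rewrite /preimage /= kerlift_kerproj.
  apply: connected_continuous_connected => //.
  exact/continuous_subspaceT/kerproj_continuous.
apply: (etrans (leaf_coad U p g)).
apply: (etrans _ (esym (leaf_coad U p h))).
exact: (congr1 (fun C => @kerlift G _ (fun h => coad h (J p)) @` C) e).
Qed.

(** Disjoint neighbourhoods of two points of the leaf space, pulled back to the
    dual of the Lie algebra. *)
Lemma not_T2_leaf (U : set 'rV[R]_d) (mu nu : 'rV[R]_d) :
  U mu -> U nu -> ~ T2_leaf G U mu nu ->
  exists2 A, nbhs mu A & exists2 B, nbhs nu B &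
    forall m v, A m -> B v -> U m -> U v -> leaf G U m <> leaf G U v.
Proof.
move=> Umu Unu nT.
pose lift m (Um : U m) : set_type U := exist _ m (mem_set Um).
pose x := lift _ Umu; pose y := lift _ Unu.
have nxy : ~ T2 (leaf_proj G x) (leaf_proj G y).
  by move=> T; apply: nT; exists x, y.
have [A' [B' [Ax By AB]]] := not_cluster_disjoint nxy.
have [A Amu AA'] := set_type_nbhs (kerproj_continuous Ax).
have [B Bnu BB'] := set_type_nbhs (kerproj_continuous By).
exists A => //; exists B => // m v Am Bv Um Uv mv.
have : (A' `&` B') (leaf_proj G (lift _ Um)).
  split; first exact: (AA' (lift _ Um)).
  have -> : leaf_proj G (lift _ Um) = leaf_proj G (lift _ Uv).
    exact/kerproj_eqP.
  exact: (BB' (lift _ Uv)).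
by rewrite AB.
Qed.

End Leaves.

(** * Motion in the slice *)

Section OrbitSpace.
Variables (R : realType) (n d : nat) (P : manifold R n) (G : lieGroup R d).
Variable act : G -> P -> P.
Hypothesis act_smth : smooth_action act.

Lemma orbit_proj_eqP (p q : P) :
  orbit_proj act p = orbit_proj act q <-> exists g, q = act g p.
Proof.
split=> [/kerproj_eqP e|[g ->]].
  have : Defs.orbit act q q by exists (gone G) => //; exact: act1 act_smth q.
  by rewrite -e => -[g _ <-]; exists g.
apply/kerproj_eqP; rewrite eqEsubset; split => _ [h _ <-].
  by exists (gmul h (ginv g)) => //; rewrite (actM act_smth) (act_gmulV act_smth).
by exists (gmul h g) => //; rewrite (actM act_smth).
Qed.

(** The slice as a continuous local section: [s] maps a point of the saturated
    open set [Sat] to the representative in [S] of its orbit. *)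
Lemma slice_section (p : P) (S : set P) : is_slice act p S ->
  exists (Sat : set P) (s : P -> P),
  [/\ open Sat, forall x, Sat x -> {for x, continuous s},
      forall x, S x -> Sat x /\ s x = x,
      forall x, Sat x -> S (s x) /\ exists g, s x = act g x &
      forall x g, Sat x -> Sat (act g x) /\ s (act g x) = s x].
Proof.
move=> slS; have [sigma sigmaK [sigma_cont _]] := slice_diffeo slS.
exists (orbit_proj act @^-1` (orbit_proj act @` S)).
exists (sigma \o orbit_proj act); split.
- exact: slice_open slS.
- exact: sigma_cont.
- by move=> x Sx; split; [exists x|exact: sigmaK].
- move=> x [y Sy yx]; rewrite /= -yx sigmaK //; split => //.
  by apply/orbit_proj_eqP.
- move=> x g Satx.
  have e : orbit_proj act (act g x) = orbit_proj act x.
    by apply/esym/orbit_proj_eqP; exists g.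
  by rewrite /preimage /= e.
Qed.

End OrbitSpace.

Section TranslatedPath.
Variables (R : realType) (n d : nat) (P : manifold R n) (G : lieGroup R d).
Variable act : G -> P -> P.
Hypotheses (act_smth : smooth_action act) (act_free : free_action act).
Hypothesis act_proper : proper_action act.
Variable J : P -> 'rV[R]_d.
Hypothesis J_equiv : forall g p, J (act g p) = coad g (J p).

(** By equivariance [J (c' r) = coad (gam r) (J (c 0))], where [gam r] carries
    [c r] to [c' r]; and [gam] is continuous, so its values form a connected
    subset of [G]. *)
Lemma leaf_translated_path (U : set 'rV[R]_d) (c c' : R -> P) (t : R) :
  0 <= t -> {within `[0, t], continuous c} -> {within `[0, t], continuous c'} ->
  (forall r, 0 <= r <= t -> exists g, c' r = act g (c r)) ->
  (forall r, 0 <= r <= t -> J (c r) = J (c 0)) ->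
  (forall r, 0 <= r <= t -> U (J (c' r))) ->
  leaf G U (J (c' t)) = leaf G U (J (c' 0)).
Proof.
move=> t0 cc cc' orb Jc UJ.
have /choice[gam gamE] : forall r, exists g : G,
    0 <= r <= t -> c' r = act g (c r).
  move=> r; have [/orb[g ->]|nrt] := pselect (0 <= r <= t); first by exists g.
  by exists (gone G).
have gam_cont : {within `[0, t], continuous gam}.
  apply/subspace_continuousP => r; rewrite /= in_itv /= => rt.
  have rt' : [set` `[0, t]] r by rewrite /= in_itv.
  apply: (translation_cvg act_smth act_proper act_free (a := c) (b := c') _).
  - exact: (subspace_continuousP _ _).1 cc r rt'.
  - by rewrite -(gamE r rt); exact: (subspace_continuousP _ _).1 cc' r rt'.
  near=> r'; apply: gamE.
  have : [set` `[0, t]] r' by near: r'; exact: withinT.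
  by rewrite /= in_itv.
have JE r : 0 <= r <= t -> coad (gam r) (J (c 0)) = J (c' r).
  by move=> rt; rewrite -(Jc _ rt) -J_equiv -gamE.
have tt : 0 <= t <= t by apply/andP; split; [exact: t0|exact: lexx].
have zt : 0 <= (0 : R) <= t by apply/andP; split; [exact: lexx|exact: t0].
rewrite -(JE t tt) -(JE 0 zt).
apply: (leaf_coad_connected act_smth J_equiv (Gam := gam @` `[0, t])).
- by apply: connected_continuous_connected gam_cont; exact: segment_connected.
- by move=> _ [r + <-]; rewrite /= in_itv /= => rt; rewrite JE //; exact: UJ.
- by exists t; rewrite //= in_itv.
- by exists 0; rewrite //= in_itv.
Unshelve. all: by end_near. Qed.

End TranslatedPath.

Section Stability.
Variables (R : realType) (n d : nat) (P : manifold R n) (G : lieGroup R d).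
Variable act : G -> P -> P.
Hypotheses (act_smth : smooth_action act) (act_free : free_action act).
Hypothesis act_proper : proper_action act.
Variable J : P -> 'rV[R]_d.
Hypothesis J_equiv : forall g p, J (act g p) = coad g (J p).
Hypothesis J_cont : continuous J.
Variables (X : P -> 'rV[R]_n) (D : set (R * P)) (Phi : R -> P -> P).
Hypothesis flowX : is_flow X D Phi.
Hypothesis X_equiv : forall g p, X (act g p) = tangent_map (act g) p (X p).
Hypothesis J_conserved : forall t p, D (t, p) -> J (Phi t p) = J p.
Variables (pe : P) (S : set P).
Hypothesis slS : is_slice act pe S.
Variables (Y : topologicalType) (f : P -> Y).
Hypotheses (Yhaus : hausdorff_space Y) (f_cont : continuous f).
Hypothesis f_conserved : forall t p, D (t, p) -> f (Phi t p) = f p.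
Hypothesis f_inv : invariant_fun act f.

(** If [f] does not separate [b] from [pe], then the leaf of the momentum does.
    Either separation persists for points near [b] and near [pe]: the one because
    [Y] is Hausdorff, the other by the definition of [T2]. *)
Lemma separated_from_equilibrium (U : set 'rV[R]_d) (b : P) :
  U (J pe) -> U (J b) -> (f b = f pe -> ~ T2_leaf G U (J pe) (J b)) ->
  \forall b' \near b & p \near pe,
    ~ [/\ f b' = f p, U (J b'), U (J p) & leaf G U (J b') = leaf G U (J p)].
Proof.
move=> Upe Ub iso; have [fb|fb] := pselect (f b = f pe).
- have [A Ape [B Bb AB]] := not_T2_leaf Upe Ub (iso fb).
  exists (J @^-1` B, J @^-1` A) => [|[b' p] [/= Bb' Ap] [_ U1 U2 e]].
    by split; apply: J_cont.
  exact: (AB (J p) (J b') Ap Bb' U2 U1 (esym e)).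
- have [A [B [Ab Bpe AB]]] : exists A B,
      [/\ nbhs (f b) A, nbhs (f pe) B & A `&` B = set0].
    apply: not_cluster_disjoint => /Yhaus; exact: fb.
  exists (f @^-1` A, f @^-1` B) => [|[b' p] [/= Ab' Bp] [e _ _ _]].
    by split; apply: f_cont.
  suff : (A `&` B) (f p) by rewrite AB.
  by split => //; rewrite -e.
Qed.

(** The trapping argument.  Here [good] holds at the points whose representative
    is interior to [K0], and [far p b] says that the conserved quantities
    distinguish [b] from [p]. *)
Lemma G_stable_of_isolating : isolating G J S pe f -> G_stable act D Phi pe.
Proof.
move=> [US [Umu [USpe [W Wo USE] Ue Umuo iso]]] U Upe U_inv.
have [Sat [s [Sat_open s_cont s_id s_S s_inv]]] := slice_section act_smth slS.
have Spe : S pe by exact: slice_mem slS.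
have [Satpe spe] := s_id _ Spe.
have [K0 [K0pe K0c K0sub]] : exists K, [/\ nbhs pe K, compact K &
    K `<=` [set x | [/\ U x, W x, Umu (J x) & Sat x]]].
  apply: manifold_locally_compact.
  have Wpe : W pe by rewrite USE in USpe; case: USpe.
  have nW : nbhs pe W by apply: open_nbhs_nbhs.
  have nJ : nbhs pe (J @^-1` Umu).
    by apply: J_cont; apply: open_nbhs_nbhs.
  have nS : nbhs pe Sat by apply: open_nbhs_nbhs.
  by near=> x; split; near: x.
(* [S] need not be closed in [P], but it is closed in [Sat], being the set of
   fixed points of [s] there; [Z] extends it to a closed subset of [P], which
   agrees with [S] on [K0]. *)
pose Z := [set x | Sat x -> s x = x].
have Zc : closed Z.
  move=> x clx Satx; apply: contrapT => sx.
  have [A [B [Asx Bx AB]]] : exists A B,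
      [/\ nbhs (s x) A, nbhs x B & A `&` B = set0].
    apply: not_cluster_disjoint => /manifold_hausdorff; exact: sx.
  have nx : nbhs x (Sat `&` (s @^-1` A) `&` B).
    apply: filterI => //; apply: filterI; last exact: s_cont.
    exact: open_nbhs_nbhs.
  have [y [Zy [[Saty Asy] By]]] := clx _ nx.
  suff : (A `&` B) y by rewrite AB.
  by split => //; rewrite -(Zy Saty).
pose K := K0 `&` Z.
have Kc : compact K by exact: compact_closedI.
pose good p := Sat p /\ K0° (s p).
pose B := K `&` ~` K0°.
have Bc : compact B.
  by apply: compact_closedI => //; exact/open_closedC/open_interior.
pose far (p b : P) :=
  ~ [/\ f b = f p, Umu (J b), Umu (J p) & leaf G Umu (J b) = leaf G Umu (J p)].
have nfar : \forall p \near pe, B `<=` far p.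
  apply: ((compact_near_coveringP B).1 Bc) => b [[K0b Zb] nb].
  have [Ub Wb Jb Satb] := K0sub _ K0b.
  apply: (@separated_from_equilibrium Umu b) => // fb T2b.
  have : (f @^-1` [set f pe] `&` J @^-1` T2_leaf G Umu (J pe) `&` US) b.
    split; first by split.
    by rewrite USE; split => //; rewrite -(Zb Satb); exact: (s_S _ Satb).1.
  by rewrite iso => bpe; apply: nb; rewrite bpe.
pose GK := [set p | exists g, K (act g p)].
have GKc : closed GK by exact: saturation_closed.
have GKP p : GK p -> Sat p /\ K (s p).
  move=> [g Kg]; have [K0g Zg] := Kg.
  have [_ _ _ Satg] := K0sub _ K0g.
  have := s_inv _ (ginv g) Satg.
  by rewrite (act_gmulV act_smth) => -[Satp ->]; split => //; rewrite Zg.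
have goodGK p : good p -> GK p.
  move=> [Satp K0p]; have [_ [g sE]] := s_S _ Satp.
  exists g; split; first by rewrite -sE; exact: interior_subset.
  by move=> _; rewrite (s_inv _ g Satp).2.
have good_nbhs p : good p -> nbhs p good.
  move=> [Satp K0p]; apply: filterI; first exact: open_nbhs_nbhs.
  apply: (s_cont _ Satp); apply: open_nbhs_nbhs.
  by split => //; exact: open_interior.
(* Paths, rather than the trajectory itself, so as to treat positive and negative
   times together. *)
have trap (c : R -> P) :
    (forall r, 0 <= r <= 1 -> {for r, continuous c}) ->
    (forall r, 0 <= r <= 1 -> f (c r) = f (c 0)) ->
    (forall r, 0 <= r <= 1 -> J (c r) = J (c 0)) ->
    good (c 0) -> B `<=` far (s (c 0)) ->
    forall r, 0 <= r <= 1 -> good (c r).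
  move=> c_cont fc Jc good0 far0.
  apply: real_induction => [t /andP[t0 t1] goodlt|t t01 goodt]; last first.
    by apply: (c_cont t t01); exact: good_nbhs.
  move: t0; rewrite le_eqVlt => /predU1P[<- //|t0].
  (* At the first time [t] at which [good] might fail the path is still in the
     closed set [G K], so its representative is defined and lies in [K]. *)
  have GKt : GK (c t).
    apply: GKc => N Nct.
    have : \forall r \near t^'-, 0 <= r < t /\ N (c r).
      near=> r; split; last first.
        near: r; apply: cvg_within; apply: (c_cont t) => //.
        by rewrite (ltW t0).
      by apply/andP; split; near: r; [exact: nbhs_left_ge|exact: nbhs_left_lt].
    by move=> /filter_ex [r [/goodlt /goodGK GKr Nr]]; exists (c r).
  have GKle r : 0 <= r <= t -> GK (c r).
    move=> /andP[r0]; rewrite le_eqVlt => /predU1P[-> //|rt].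
    by apply/goodGK/goodlt; rewrite r0.
  have le1 r : 0 <= r <= t -> 0 <= r <= 1.
    by move=> /andP[-> rt]; exact: le_trans t1.
  have UJ r : 0 <= r <= t -> Umu (J (s (c r))).
    by move=> rt; have [_ [/K0sub []]] := GKP _ (GKle r rt).
  have tt : 0 <= t <= t by apply/andP; split; [exact: ltW|exact: lexx].
  have zt : 0 <= (0 : R) <= t by apply/andP; split; [exact: lexx|exact: ltW].
  have leafE : leaf G Umu (J (s (c t))) = leaf G Umu (J (s (c 0))).
    apply: (leaf_translated_path act_smth act_free act_proper J_equiv
      (c := c) (c' := s \o c) (ltW t0)).
    - apply: continuous_in_subspaceT => r; rewrite inE /= in_itv /= => /le1.
      exact: c_cont.
    - apply: continuous_in_subspaceT => r; rewrite inE /= in_itv /= => rt.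
      apply: (continuous_comp (c_cont r (le1 r rt))).
      exact: (s_cont _ (GKP _ (GKle r rt)).1).
    - by move=> r rt; exact: (s_S _ (GKP _ (GKle r rt)).1).2.
    - by move=> r /le1; exact: Jc.
    - exact: UJ.
  have fs r : 0 <= r <= t -> f (s (c r)) = f (c 0).
    move=> rt; have [_ [g ->]] := s_S _ (GKP _ (GKle r rt)).1.
    by rewrite f_inv (fc _ (le1 r rt)).
  have [Satt Kt] := GKP _ GKt.
  split => //; apply: contrapT => nK0.
  apply: (far0 (s (c t))); first by split.
  by split; rewrite ?fs //; exact: UJ.
exists [set p | good p /\ B `<=` far (s p)].
  apply: filterI; first by apply: good_nbhs; split => //; rewrite spe.
  have sc : s @ nbhs pe --> s pe := s_cont _ Satpe; rewrite spe in sc.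
  exact: (sc _ nfar).
move=> p [goodp farp].
have goodt t : D (t, p) -> good (Phi t p).
  move=> Dt.
  have Dr r : 0 <= r <= 1 -> D (r * t, p).
    move=> /andP[r0 r1]; have D0 := flow_dom0 flowX p.
    have [t0|/ltW t0] := leP 0 t.
      apply: (flow_interval flowX D0 Dt).
      by rewrite mulr_ge0 //= ler_piMl.
    apply: (flow_interval flowX Dt D0).
    by rewrite mulr_ge0_le0 // andbT ler_niMl.
  have c0 : Phi (0 * t) p = p by rewrite mul0r (flow0 flowX).
  rewrite -[t]mul1r; apply: (trap (fun r => Phi (r * t) p)).
  - move=> r /Dr Drt.
    have mc : {for r, continuous (fun r : R => r * t)}.
      exact: (cvgM (@cvg_id _ (nbhs r)) (cvg_cst t)).
    exact: (continuous_comp mc (flow_curve_continuous flowX Drt)).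
  - by move=> r /Dr Drt; rewrite c0 f_conserved.
  - by move=> r /Dr Drt; rewrite c0 J_conserved.
  - by rewrite c0.
  - by rewrite c0.
  - by rewrite ler01 lexx.
have Dp : forall t, D (t, p).
  apply: (flow_complete_of_cocompact flowX act_smth X_equiv Kc) => t Dt.
  exact/goodGK/goodt.
move=> t; split; first exact: Dp.
have [Satt /interior_subset /K0sub [Ut _ _ _]] := goodt t (Dp t).
have [_ [g sE]] := s_S _ Satt.
rewrite -(act_gmulV act_smth g (Phi t p)); apply: U_inv.
by rewrite -sE.
Unshelve. all: by end_near. Qed.

End Stability.

Theorem theorem4p2 (R : realType) (n d : nat)
  (P : manifold R n) (omega : P -> 'M[R]_n) (Homega : symplectic_form omega)
  (G : lieGroup R d) (act : G -> P -> P) (Hact : smooth_action act)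
  (Hfree : free_action act) (Hproper : proper_action act)
  (Hsymp : symplectic_action omega act)
  (J : P -> 'rV[R]_d) (HJ : equivariant_momentum_map omega act J)
  (H : P -> R) (Hsmooth : smooth_fun H) (Hinv : invariant_fun act H)
  (XH : P -> 'rV[R]_n) (HXH : hamiltonian_field omega H XH)
  (D : set (R * P)) (Phi : R -> P -> P) (HPhi : is_flow XH D Phi)
  (pe : P) (Hpe : relative_equilibrium act XH pe)
  (S : set P) (HS : is_slice act pe S) :
  (isolating G J S pe H -> G_stable act D Phi pe) /\
  (forall (Y : topologicalType) (f : P -> Y),
     hausdorff_space Y -> conserved D Phi f -> invariant_fun act f ->
     isolating G J S pe f -> G_stable act D Phi pe).
Proof.
have stable (Y : topologicalType) (f : P -> Y) : hausdorff_space Y ->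
    conserved D Phi f -> invariant_fun act f ->
    isolating G J S pe f -> G_stable act D Phi pe.
  move=> Yhaus [f_cont f_cons] f_inv.
  apply: (G_stable_of_isolating Hact Hfree Hproper (momentum_equivariant HJ)
    _ HPhi _ _ HS Yhaus f_cont f_cons f_inv).
  - move=> p; apply/chart_differentiable_continuous.
    exact/smooth_chart_differentiable/(momentum_smooth HJ).
  - apply: (hamiltonian_field_equivariant Hact Homega Hsymp _ Hinv HXH) => p.
    exact: smooth_chart_differentiable.
  - exact: (momentum_conserved Homega Hact Hsmooth HXH HPhi Hinv HJ).
split; last exact: stable.
apply: stable Hinv; first exact: Rhausdorff.
exact: (hamiltonian_conserved Homega Hsmooth HXH HPhi).
Qed.
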